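(* Let $m\in\mathbb{N}$, $m\ge1$, let $A\subseteq\mathbb{N}^m$ be a finite non-empty complete set of multi-indices, for $i=1,\dots,m$ let $n_i=\max_{\alpha\in A}\alpha_i$ and let $p_{0,i},\dots,p_{n_i,i}$ be pairwise distinct real numbers, and let $P_A=\{p_\alpha : \alpha\in A\}$ with $p_\alpha=(p_{\alpha_1,1},\dots,p_{\alpha_m,m})\in\mathbb{R}^m$. Let $f:\mathbb{R}^m\to\mathbb{R}$ be a function. Then the unique polynomial $Q_{f,A}\in\Pi_A$ interpolating $f$ on $P_A$, i.e. satisfying $Q_{f,A}(p)=f(p)$ for all $p\in P_A$, can be determined in $\mathcal{O}(|A|^2)$ operations requiring $\mathcal{O}(|A|)$ storage, and it is given by $$Q_{f,A}(x)=\sum_{\alpha\in A}c_\alpha N_\alpha(x),$$ where $N_\alpha$ are the multivariate Newton polynomials and $c_\alpha=F_{\alpha,0,0}$ are the Newton coefficients given by the multivariate divided differences of $f$.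
   Context: $\mathbb{N}$ contains $0$ when used for multi-indices. $\Pi_A=\mathrm{span}\{x^\alpha:\alpha\in A\}$ is the space of real polynomials in $x_1,\dots,x_m$ spanned by the monomials $x^\alpha=x_1^{\alpha_1}\cdots x_m^{\alpha_m}$, $\alpha\in A$. $A$ is complete (downward closed) if $\alpha\in A$, $\beta\in\mathbb{N}^m$ and $\beta_i\le\alpha_i$ for all $i$ imply $\beta\in A$. Multivariate Newton polynomials: $N_\alpha(x)=\prod_{i=1}^m\prod_{j=0}^{\alpha_i-1}(x_i-p_{j,i})$ for $\alpha\in A$ (empty products are $1$). Multivariate divided differences: the real numbers $F_{\alpha,i,j}$, for $\alpha\in A$, $1\le j\le m$, $0\le i\le\alpha_j$, are defined recursively, with $j$ running from $m$ down to $1$ and $i$ upwards, by $$F_{\alpha,0,m}=f(p_\alpha),\qquad F_{\alpha,0,j}=F_{\alpha,\alpha_{j+1},j+1}\quad(1\le j<m),$$ $$F_{\alpha,i,j}=\frac{F_{\alpha,i-1,j}-F_{\beta,i-1,j}}{p_{\alpha_j,j}-p_{i-1,j}}\quad(1\le i\le\alpha_j),$$ where $\beta=\beta(\alpha,i,j)\in A$ is the multi-index with $\beta_j=i-1$ and $\beta_k=\alpha_k$ for all $k\ne j$. The Newton coefficients are $F_{\alpha,0,0}:=F_{\alpha,\alpha_1,1}$. Operations are real arithmetic operations, storage is the number of stored real numbers, the values $f(p_\alpha)$, $\alpha\in A$, and the nodes are given as input, ''determined'' means computing the coefficients $c_\alpha$, $\alpha\in A$, and the implied constants are absolute. *)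

(* Defs.v *)
From HB Require Import structures.
From mathcomp Require Import all_boot all_order all_algebra finmap.
From mathcomp Require Import mpoly.
From mathcomp Require Import reals.

Set Implicit Arguments.
Unset Strict Implicit.
Unset Printing Implicit Defensive.

Import Order.TTheory GRing.Theory Num.Theory.

Local Open Scope ring_scope.

(* Coordinates are numbered from 0: the coordinate j = 1, ..., m of the
   mathematical text is the ordinal j - 1 : 'I_m here.  Only the coordinate
   index is shifted; node indices and multi-index entries are not. *)

Definition complete (m : nat) (A : {fset 'X_{1..m}}) : Prop :=
  forall a b : 'X_{1..m}, a \in A -> (forall i, (b i <= a i)%N) -> b \in A.

(* n_i *)
Definition maxdeg (m : nat) (A : {fset 'X_{1..m}}) (i : 'I_m) : nat :=
  (\max_(a <- A) a i)%N.

Section Newton.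

Variables (R : realType) (m : nat).

(* p k i is the node p_{k,i}.  Entries with k > n_i are junk: no hypothesis is
   made on them and nothing below depends on them for multi-indices in A. *)
Implicit Type p : nat -> 'I_m -> R.
Implicit Type f : 'rV[R]_m -> R.

Definition distinct_nodes (A : {fset 'X_{1..m}}) p : Prop :=
  forall (i : 'I_m) (k l : nat),
    (k <= maxdeg A i)%N -> (l <= maxdeg A i)%N -> p k i = p l i -> k = l.

Definition grid_pt p (a : 'X_{1..m}) : 'rV[R]_m := \row_(i < m) p (a i) i.

Definition in_Pi (A : {fset 'X_{1..m}}) (Q : {mpoly R[m]}) : Prop :=
  exists c : 'X_{1..m} -> R, Q = \sum_(a <- A) c a *: 'X_[a].

Definition interpolates (A : {fset 'X_{1..m}}) p f (Q : {mpoly R[m]}) : Prop :=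
  forall a : 'X_{1..m}, a \in A ->
    Q.@[fun i => grid_pt p a ord0 i] = f (grid_pt p a).

Definition newton_poly p (a : 'X_{1..m}) : {mpoly R[m]} :=
  \prod_(i < m) \prod_(j < a i) ('X_i - (p j i)%:MP).

Definition mset (a : 'X_{1..m}) (j : 'I_m) (i : nat) : 'X_{1..m} :=
  [multinom (if k == j then i else a k) | k < m].

(* F_{a,i,j} as a function of i and a, where G a stands for F_{a,0,j}. *)
Fixpoint dd_along p (j : 'I_m) (G : 'X_{1..m} -> R) (i : nat)
    (a : 'X_{1..m}) : R :=
  if i is i'.+1 then
    (dd_along p j G i' a - dd_along p j G i' (mset a j i'))
      / (p (a j) j - p i' j)
  else G a.

(* The directions in s are treated one after the other, the last one first. *)
Definition dd_dirs p f (s : seq 'I_m) : 'X_{1..m} -> R :=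
  foldr (fun j G a => dd_along p j G (a j) a) (fun a => f (grid_pt p a)) s.

(* F_{a,i,j}; the lemmas below are its defining recursion. *)
Definition divdiff p f (a : 'X_{1..m}) (i : nat) (j : 'I_m) : R :=
  dd_along p j (dd_dirs p f (drop j.+1 (enum 'I_m))) i a.

(* F_{a,0,0} *)
Definition newton_coef p f (a : 'X_{1..m}) : R := dd_dirs p f (enum 'I_m) a.

Lemma drop_enum_ord (j : 'I_m) :
  drop j (enum 'I_m) = j :: drop j.+1 (enum 'I_m).
Proof. by rewrite (drop_nth j) ?size_enum_ord // nth_ord_enum. Qed.

Lemma divdiff0_last p f a (j : 'I_m) : j.+1 = m ->
  divdiff p f a 0 j = f (grid_pt p a).
Proof. by move=> jm; rewrite /divdiff drop_oversize // size_enum_ord jm. Qed.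

Lemma divdiff0 p f a (j j' : 'I_m) : j' = j.+1 :> nat ->
  divdiff p f a 0 j = divdiff p f a (a j') j'.
Proof. by move=> jj'; rewrite /divdiff /= -jj' drop_enum_ord. Qed.

Lemma divdiffS p f a i (j : 'I_m) :
  divdiff p f a i.+1 j =
  (divdiff p f a i j - divdiff p f (mset a j i) i j) / (p (a j) j - p i j).
Proof. by []. Qed.

Lemma newton_coefE p f a (j : 'I_m) : j = 0%N :> nat ->
  newton_coef p f a = divdiff p f a (a j) j.
Proof.
by move=> j0; rewrite /newton_coef -[enum _]drop0 -j0 drop_enum_ord.
Qed.

End Newton.

(* Straight-line programs over the reals.  The inputs are read-only and are
   exactly the values f(p_a), a in A, and the nodes p_{k,i}, 0 <= k <= n_i.
   A program works on S registers, each holding one real number; it depends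
   neither on the numerical inputs nor on the field, and has no constants. *)

Inductive input (m : nat) (A : {fset 'X_{1..m}}) : Type :=
| InValue of A
| InNode (i : 'I_m) of 'I_(maxdeg A i).+1.

Inductive arith_op : Type := OpAdd | OpSub | OpMul | OpDiv.

Inductive instr (m : nat) (A : {fset 'X_{1..m}}) (S : nat) : Type :=
| Fetch (dst : 'I_S) (x : input A)
| Arith (dst : 'I_S) (op : arith_op) (src1 src2 : 'I_S).

Definition is_arith m (A : {fset 'X_{1..m}}) S (c : instr A S) : bool :=
  if c is Arith _ _ _ _ then true else false.

Definition num_ops m (A : {fset 'X_{1..m}}) S (prog : seq (instr A S)) : nat :=
  count (@is_arith m A S) prog.

Section Exec.

Variables (R : realType) (m : nat) (A : {fset 'X_{1..m}}) (S : nat).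

Definition read_input (p : nat -> 'I_m -> R) (f : 'rV[R]_m -> R)
    (x : input A) : R :=
  match x with
  | InValue a => f (grid_pt p (val a))
  | InNode i k => p k i
  end.

(* Dividing by zero aborts the computation. *)
Definition eval_op (op : arith_op) (x y : R) : option R :=
  match op with
  | OpAdd => Some (x + y)
  | OpSub => Some (x - y)
  | OpMul => Some (x * y)
  | OpDiv => if y == 0 then None else Some (x / y)
  end.

Definition write (s : {ffun 'I_S -> R}) (dst : 'I_S) (v : R) :
    {ffun 'I_S -> R} :=
  [ffun r => if r == dst then v else s r].

Definition exec_instr (inp : input A -> R) (c : instr A S)
    (s : {ffun 'I_S -> R}) : option {ffun 'I_S -> R} :=
  match c with
  | Fetch dst x => Some (write s dst (inp x))
  | Arith dst op r1 r2 => omap (write s dst) (eval_op op (s r1) (s r2))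
  end.

Definition exec (inp : input A -> R) (prog : seq (instr A S)) :
    option {ffun 'I_S -> R} :=
  foldl (fun os c => obind (exec_instr inp c) os) (Some [ffun=> 0]) prog.

(* The run succeeds and leaves c a, for all a in A at once, in the register
   out a. *)
Definition computes (inp : input A -> R) (prog : seq (instr A S))
    (out : A -> 'I_S) (c : 'X_{1..m} -> R) : Prop :=
  exists s : {ffun 'I_S -> R},
    exec inp prog = Some s /\ forall a : A, s (out a) = c (val a).

End Exec.

(* Main.v *)
Require Import Defs.
From mathcomp Require Import all_boot all_order all_algebra finmap.
From mathcomp Require Import mpoly.
From mathcomp Require Import reals.

Set Implicit Arguments.
Unset Strict Implicit.
Unset Printing Implicit Defensive.

Import Order.TTheory GRing.Theory Num.Theory.

Local Open Scope ring_scope.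

(* In one direction, G(a) is the Newton sum of the divided differences of G, so
   inverting the directions one after the other writes f(p_b) as the sum of
   c_a N_a(p_b) over a <= b; the terms with a not below b vanish, since N_a(p_b)
   has then a zero factor.  Hence the Newton sum interpolates arbitrary data on
   the grid; uniqueness follows because a surjective square system is injective.

   The divided differences are computed in place, in |A| registers plus two
   scratch ones, with three operations per triple (a, j, i), i < a_j.  There are
   sum_a |a| such triples, and |a| < |A| because A contains a maximal chain from
   0 to a. *)

(** * Multi-indices and complete sets *)

Lemma msetE m (a : 'X_{1..m}) j i k :
  mset a j i k = if k == j then i else a k.
Proof. by rewrite mnmE. Qed.

Lemma mset_id m (a : 'X_{1..m}) j : mset a j (a j) = a.
Proof. by apply/mnmP => k; rewrite msetE; case: eqP => // ->. Qed.

Lemma mset_mset m (a : 'X_{1..m}) j i k : mset (mset a j i) j k = mset a j k.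
Proof. by apply/mnmP => l; rewrite !msetE; case: eqP. Qed.

Lemma mset_in m (A : {fset 'X_{1..m}}) (a : 'X_{1..m}) j i :
  complete A -> a \in A -> (i <= a j)%N -> mset a j i \in A.
Proof.
by move=> cA aA ij; apply: (cA _ _ aA) => k; rewrite msetE; case: eqP => // ->.
Qed.

Lemma leq_maxdeg m (A : {fset 'X_{1..m}}) (a : 'X_{1..m}) j :
  a \in A -> (a j <= maxdeg A j)%N.
Proof. by move=> aA; exact: leq_bigmax_seq. Qed.

(** Induction on the degree: deleting [a] from [A] keeps everything below [a - U_(j)], for some [j]
    with [0 < a j]. The hypothesis concerns only the indices below [a] because the deletion may
    destroy completeness. *)
Lemma mdeg_lt_card m (A : {fset 'X_{1..m}}) (a : 'X_{1..m}) :
  (forall b : 'X_{1..m}, (b <= a)%MM -> b \in A) -> (mdeg a < #|` A|)%N.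
Proof.
elim: {a}(mdeg a) {-2}a (erefl (mdeg a)) A => [|d IHd] a da A subA.
  by rewrite da cardfs_gt0; apply/fset0Pn; exists a; apply/subA/lepm_refl.
have aA : a \in A by apply/subA/lepm_refl.
have [j aj_gt0] : exists j, (0 < a j)%N.
  case: (pickP (fun j => 0 < a j)%N) => [j aj|a0]; first by exists j.
  move: da; rewrite mdegE big1 // => i _.
  by apply/eqP; rewrite -leqn0 leqNgt a0.
have Uj_le : (U_(j) <= a)%MM.
  by apply/mnm_lepP => i; rewrite mnm1E; case: eqP => [<-|].
rewrite (cardfsD1 a) aA ltnS.
have da' : mdeg (a - U_(j))%MM = d.
  have := congr1 (@mdeg _) (submK Uj_le); rewrite mdegD mdeg1 da addn1.
  by case.
rewrite da -{1}da'; apply: IHd => // b le_b; rewrite !inE; apply/andP; split.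
  apply/negP => /eqP b_a; have /mnm_lepP/(_ j) := le_b.
  by rewrite b_a mnmBE mnm1E eqxx leqNgt ltn_subrL aj_gt0.
apply: subA; apply: lepm_trans le_b _; exact: lem_subr.
Qed.

(** * Newton interpolation on the grid: existence and uniqueness *)

Section Interpolation.

Variables (R : realType) (m : nat).
Implicit Types (p : nat -> 'I_m -> R) (f : 'rV[R]_m -> R).
Implicit Types (g G : 'X_{1..m} -> R) (a b : 'X_{1..m}).

Definition newton_uni p (j : 'I_m) (k : nat) (x : R) : R :=
  \prod_(l < k) (x - p l j).

Lemma newton_uniS p j k x :
  newton_uni p j k.+1 x = newton_uni p j k x * (x - p k j).
Proof. exact: big_ord_recr. Qed.

Lemma newton_uni_eq0 p j k l : (l < k)%N -> newton_uni p j k (p l j) = 0.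
Proof.
by move=> lk; rewrite /newton_uni (bigD1 (Ordinal lk)) //= subrr mul0r.
Qed.

Lemma newton_polyE p a (v : 'I_m -> R) :
  (newton_poly p a).@[v] = \prod_(i < m) newton_uni p i (a i) (v i).
Proof.
rewrite /newton_poly rmorph_prod; apply: eq_bigr => i _.
rewrite rmorph_prod; apply: eq_bigr => j _.
by rewrite /= mevalB mevalXU mevalC.
Qed.

(** Newton's formula with remainder. The recursion, multiplied by its denominator, splits the
    remainder of order [i] into the next Newton term and the remainder of order [i.+1]. *)
Lemma dd_along_sum_rem p j G a i :
  (forall k, (k < i)%N -> p (a j) j != p k j) ->
  G a = \sum_(k < i) dd_along p j G k (mset a j k)
                       * newton_uni p j k (p (a j) j)
        + dd_along p j G i a * newton_uni p j i (p (a j) j).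
Proof.
elim: i => [|i IHi] neq.
  by rewrite big_ord0 add0r /newton_uni big_ord0 mulr1.
rewrite {1}IHi; last by move=> k ki; apply/neq/ltnW.
rewrite big_ord_recr /= -addrA; congr (_ + _).
rewrite newton_uniS.
have nz : p (a j) j - p i j != 0 by rewrite subr_eq0 neq.
by rewrite [_ * (p (a j) j - _)]mulrC mulrA divfK // -mulrDl addrC subrK.
Qed.

(** For [i = a j] the remainder is itself the last Newton term, since [mset a j (a j) = a]. *)
Lemma dd_along_sum p j G a :
  (forall k, (k < a j)%N -> p (a j) j != p k j) ->
  G a = \sum_(k < (a j).+1) dd_along p j G k (mset a j k)
                       * newton_uni p j k (p (a j) j).
Proof.
move=> neq; rewrite {1}(dd_along_sum_rem (i := a j) _ neq).
by rewrite big_ord_recr /= mset_id.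
Qed.

(** [dd_dirs] for arbitrary data [g] on multi-indices; the surjectivity argument needs data that are
    not given by a function on points. *)
Definition dd_iter p g (s : seq 'I_m) : 'X_{1..m} -> R :=
  foldr (fun j G a => dd_along p j G (a j) a) g s.

Section Grid.

Variables (A : {fset 'X_{1..m}}) (p : nat -> 'I_m -> R).
Hypotheses (cA : complete A) (dp : distinct_nodes A p).

Lemma node_neq j a k : a \in A -> (k < a j)%N -> p (a j) j != p k j.
Proof.
move=> aA kaj; apply/eqP => eqp; have le_aj := leq_maxdeg j aA.
have eqk := dp le_aj (leq_trans (ltnW kaj) le_aj) eqp.
by rewrite -eqk ltnn in kaj.
Qed.

(** The indices that occur once the directions in [s] are inverted: outside [s] they still agree
    with [b]. *)
Definition below_on (s : seq 'I_m) b : pred A :=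
  fun a : A => (val a <= b)%MM && [forall k, (k \in s) || (val a k == b k)].

(** Induction on [s]: the one-direction formula along [j] is applied to each term of the sum for
    [s]. Such a term has [a j = b j] because [j] is not in [s]. *)
Lemma dd_iter_sum_below g (s : seq 'I_m) b : uniq s -> b \in A ->
  g b = \sum_(a : A | below_on s b a) dd_iter p g s (val a)
          * \prod_(j <- s) newton_uni p j (val a j) (p (b j) j).
Proof.
move=> us bA; elim: s us => [|j s IHs] /= => [_|/andP[js us]].
  rewrite (big_pred1 [` bA]%fset) /= => [|a]; first by rewrite big_nil mulr1.
  apply/andP/eqP => [[_ /forallP eqab]|->].
    by apply/val_inj/mnmP => k; apply/eqP/eqab.
  by split=> //; apply/forallP=> k /=.
rewrite {}IHs //.
(* [h] resets the [j]-entry to [b j] and so maps the indices for [j :: s] to those for [s]. The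
   default of [insubd] is never met for indices below [b]. *)
pose h (a : A) : A := insubd [` bA]%fset (mset (val a) j (b j)).
have hE (a : A) : (val a <= b)%MM -> val (h a) = mset (val a) j (b j).
  move=> /mnm_lepP ab; rewrite insubdK //; apply: (cA bA) => k.
  by rewrite msetE; case: eqP => // ->.
rewrite [RHS](partition_big h (below_on s b)) /=; last first.
  move=> a /andP[ab /forallP eqab]; apply/andP; split.
    apply/mnm_lepP => k; rewrite hE // msetE; case: (k =P j) => [->//|_].
    exact: (mnm_lepP ab).
  apply/forallP => k; rewrite hE // msetE; case: (k =P j) => [->|/eqP kj].
    by rewrite eqxx orbT.
  by have := eqab k; rewrite inE (negPf kj).
apply: eq_bigr => a /andP[ab /forallP eqab].
have aj : val a j = b j by apply/eqP; have := eqab j; rewrite (negPf js).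
have aA : val a \in A by exact: valP.
rewrite (dd_along_sum (p := p) (j := j) (dd_iter p g s)); last first.
  by move=> k; apply: node_neq.
rewrite mulr_suml.
have upE (k : 'I_(b j).+1) :
    val (insubd a (mset (val a) j k) : A) = mset (val a) j k.
  by rewrite insubdK //; apply: mset_in => //; rewrite aj -ltnS.
rewrite /= in ab eqab aj aA upE.
(* The fibre of [h] over [a] consists of the [mset a j k] with [k <= b j], which are exactly the
   terms of the one-direction formula. *)
rewrite (reindex_onto (fun k : 'I_(b j).+1 => insubd a (mset (val a) j k) : A)
  (fun a' : A => inord (val a' j))) /=; last first.
  move=> a' /andP[/andP[a'b eq'] /eqP ha']; apply/val_inj.
  rewrite /= upE inordK ?ltnS; last exact: (mnm_lepP a'b).
  by rewrite -ha' -[fsval (h _)]/(val (h _)) hE // mset_mset mset_id.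
rewrite aj; apply: eq_big => k.
  rewrite /below_on /= upE msetE eqxx inord_val eqxx andbT; symmetry.
  have le_k : (mset (fsval a) j k <= b)%MM.
    apply/mnm_lepP => l; rewrite msetE; case: eqP => [->|_].
      by rewrite -ltnS.
    exact: (mnm_lepP ab).
  rewrite le_k /=; apply/andP; split.
    apply/forallP => l; rewrite inE msetE; case: (l =P j) => //= _; exact: eqab.
  by apply/eqP/val_inj; rewrite hE /= upE // mset_mset -aj mset_id.
move=> _; rewrite upE msetE eqxx big_cons -mulrA; congr (_ * _).
rewrite !msetE eqxx; congr (_ * _); apply: eq_big_seq => l ls.
by rewrite msetE; case: eqP ls js => [->->|].
Qed.

Definition newton_interp g : {mpoly R[m]} :=
  \sum_(a <- A) dd_iter p g (enum 'I_m) a *: newton_poly p a.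

Lemma newton_interp_eval g b : b \in A ->
  (newton_interp g).@[fun i => grid_pt p b ord0 i] = g b.
Proof.
move=> bA; rewrite (dd_iter_sum_below g (enum_uniq 'I_m) bA).
rewrite /newton_interp raddf_sum big_seq_fsetE /=.
rewrite (bigID (below_on (enum 'I_m) b)) /= addrC big1 ?add0r => [|a nab].
  apply: eq_bigr => a _; rewrite mevalZ newton_polyE big_enum /=.
  by congr (_ * _); apply: eq_bigr => i _; rewrite mxE.
have : ~~ (val a <= b)%MM.
  apply: contra nab => ab; apply/andP; split=> //; apply/forallP=> k.
  by rewrite mem_enum.
rewrite negb_forall => /existsP[j]; rewrite -ltnNge => ltj.
by rewrite mevalZ newton_polyE (bigD1 j) //= mxE newton_uni_eq0 // mul0r mulr0.
Qed.

(** A factor in the variable ['X_j] has its support below [U_(j)], and such bounds add up under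
    products. With completeness this puts the Newton polynomials into the span of the monomials of
    [A]. *)
Lemma msupp_newton_poly a b : b \in msupp (newton_poly p a) -> (b <= a)%MM.
Proof.
have lin j k : {in msupp ('X_j - (p k j)%:MP : {mpoly R[m]}),
    forall c, (c <= U_(j))%MM}.
  move=> c /msuppB_le; rewrite mem_cat msuppX inE => /orP[/eqP->|].
    exact: lepm_refl.
  by rewrite msuppC; case: eqP => // _; rewrite inE => /eqP->;
    apply/mnm_lepP => i; rewrite mnm0E.
have prodP (I : Type) (r : seq I) (F : I -> {mpoly R[m]}) (e : I -> 'X_{1..m}) :
    (forall i, {in msupp (F i), forall c, (c <= e i)%MM}) ->
    {in msupp (\prod_(i <- r) F i),
      forall c, (c <= \sum_(i <- r) e i)%MM}.
  move=> FP; elim: r => [|i r IHr] c.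
    by rewrite !big_nil msupp1 inE => /eqP->; apply: lepm_refl.
  rewrite !big_cons => /msuppM_le /allpairsP[[c1 c2] /= [c1P c2P ->]].
  have := FP _ _ c1P; have := IHr _ c2P; move=> /mnm_lepP h2 /mnm_lepP h1.
  by apply/mnm_lepP => k; rewrite !mnmDE leq_add.
move=> /(prodP _ _ _ (fun i => (\sum_(j < a i) U_(i))%MM)) le_b.
apply: lepm_trans (le_b _) _ => [i|]; first exact: prodP.
apply/mnm_lepP => i; rewrite mnm_sumE (bigD1 i) //= mnm_sumE.
under eq_bigr do rewrite mnm1E eqxx.
rewrite sum1_card card_ord big1 ?addn0 // => k ki.
by rewrite mnm_sumE big1 // => l _; rewrite mnm1E (negPf ki).
Qed.

Lemma in_Pi_coeff (Q : {mpoly R[m]}) :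
  (forall b, b \notin A -> Q@_b = 0) -> in_Pi A Q.
Proof.
move=> Q0; exists (fun a => Q@_a); apply/mpolyP => b; rewrite raddf_sum /=.
under eq_bigr do rewrite mcoeffZ mcoeffX.
have [bA|bA] := boolP (b \in A).
  rewrite (big_fsetD1 b) //= eqxx mulr1 big_seq big1 ?addr0 // => c.
  by rewrite !inE => /andP[/negPf->]; rewrite mulr0.
rewrite Q0 // big_seq big1 // => c; case: eqP bA => [->/negPf->//|_ _ _].
by rewrite mulr0.
Qed.

Lemma newton_interp_in_Pi g : in_Pi A (newton_interp g).
Proof.
apply: in_Pi_coeff => b bA; rewrite raddf_sum /= big_seq big1 // => a aA.
rewrite mcoeffZ (memN_msupp_eq0 (m := b)) ?mulr0 //.
by apply: contra bA => /msupp_newton_poly/mnm_lepP; apply: cA.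
Qed.

(* The evaluation matrix is square, and it is surjective since every data set
   on the grid has an interpolant; hence it is injective. *)
Lemma in_Pi_eval_inj (Q Q' : {mpoly R[m]}) : in_Pi A Q -> in_Pi A Q' ->
  (forall b, b \in A ->
     Q.@[fun i => grid_pt p b ord0 i] = Q'.@[fun i => grid_pt p b ord0 i]) ->
  Q = Q'.
Proof.
move=> [c ->] [c' ->] eqQ.
pose M : 'M[R]_(#|{: A}|) := \matrix_(i, j)
  ('X_[val (enum_val i)] : {mpoly R[m]}).@[
     fun k => grid_pt p (val (enum_val j)) ord0 k].
pose vec (d : 'X_{1..m} -> R) : 'rV[R]_(#|{: A}|) :=
  \row_i d (val (enum_val i)).
have vecM d : vec d *m M = \row_j (\sum_(a <- A) d a *: 'X_[a]).@[
     fun k => grid_pt p (val (enum_val j)) ord0 k].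
  apply/rowP => j; rewrite !mxE raddf_sum big_seq_fsetE /=.
  rewrite [RHS](reindex_onto (@enum_val _ _) enum_rank) /=; last first.
    by move=> i _; rewrite enum_rankK.
  by apply: eq_big => [i|i _]; rewrite ?enum_valK ?eqxx // !mxE mevalZ.
(* Each unit vector [v], extended by zero to data [g], is the vector of values of its Newton
   interpolant, hence lies in the row space of [M]. *)
have fullM : row_full M.
  rewrite -sub1mx; apply/row_subP => i; set v := row _ _.
  pose g b := if insub b is Some b' then v ord0 (enum_rank (b' : A)) else 0.
  have [d dP] := newton_interp_in_Pi g.
  apply/submxP; exists (vec d); rewrite vecM -dP; apply/rowP => j.
  rewrite [RHS]mxE newton_interp_eval; last exact: valP.
  by rewrite /g valK enum_valK.
have freeM : row_free M by rewrite row_free_unit -row_full_unit.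
suff /rowP eqv : vec c = vec c'.
  rewrite !big_seq_fsetE; apply: eq_bigr => a _; congr (_ *: _).
  by have := eqv (enum_rank a); rewrite !mxE enum_rankK.
apply: (row_free_inj freeM); rewrite !vecM; apply/rowP => j.
by rewrite !mxE; apply: eqQ; exact: valP.
Qed.

End Grid.
End Interpolation.

(** * The straight-line program and its operation count *)

Lemma sum_ltn (n k : nat) : (\sum_(i <- iota 0 n) (i < k) = minn n k)%N.
Proof.
elim: n => [|n IHn]; first by rewrite big_nil min0n.
rewrite -addn1 iotaD big_cat big_seq1 /= IHn add0n addn1.
case: (ltnP n k) => [nk|kn].
  by rewrite (minn_idPl nk) addn1.
by rewrite (minn_idPr (leqW kn)) addn0.
Qed.

Section Program.

Variables (m : nat) (A : {fset 'X_{1..m}}).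

Let S := (#|{: A}| + 2)%N.
Local Notation prog := (seq (instr A S)).

Definition reg (a : A) : 'I_S := lshift 2 (enum_rank a).
Definition tmp (i : 'I_2) : 'I_S := rshift #|{: A}| i.

(** [inord] is faithful for [k <= maxdeg A j], which covers all the nodes fetched for indices of
    [A]. *)
Definition node_input (j : 'I_m) (k : nat) : input A :=
  @InNode m A j (inord k).

(** The denominator is recomputed from the nodes each time, so two scratch registers suffice. The
    default of [insubd] is harmless: for complete [A] and [i < val a j] the operand lies in [A]. *)
Definition dd_block (j : 'I_m) (i : nat) (a : A) : prog :=
  [:: Fetch (tmp ord0) (node_input j (val a j));
      Fetch (tmp ord_max) (node_input j i);
      Arith A (tmp ord0) OpSub (tmp ord0) (tmp ord_max);
      Arith A (tmp ord_max) OpSub (reg a)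
        (reg (insubd a (mset (val a) j i)));
      Arith A (reg a) OpDiv (tmp ord_max) (tmp ord0)].

Definition dd_stage (j : 'I_m) (i : nat) : prog :=
  flatten [seq dd_block j i a | a <- enum [pred a : A | (i < val a j)%N]].

Definition dd_dir (j : 'I_m) : prog :=
  flatten [seq dd_stage j i | i <- iota 0 (maxdeg A j)].

Definition load_values : prog :=
  flatten [seq [:: Fetch (reg a) (InValue a)] | a <- enum {: A}].

Definition newton_prog (s : seq 'I_m) : prog :=
  foldr (fun j acc => acc ++ dd_dir j) load_values s.

Lemma num_ops_cat (q1 q2 : prog) :
  num_ops (q1 ++ q2) = (num_ops q1 + num_ops q2)%N.
Proof. exact: count_cat. Qed.

Lemma num_ops_flatten (T : Type) (body : T -> prog) (l : seq T) :
  num_ops (flatten [seq body x | x <- l]) = (\sum_(x <- l) num_ops (body x))%N.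
Proof.
by elim: l => [|x l IHl]; rewrite ?big_nil // big_cons /= num_ops_cat IHl.
Qed.

Lemma num_ops_stage j i :
  num_ops (dd_stage j i) = (\sum_(a : A) 3 * (i < val a j))%N.
Proof.
rewrite num_ops_flatten big_enum /= big_mkcond; apply: eq_bigr => a _ /=.
by rewrite inE; case: ltnP.
Qed.

(** After exchanging the sums, [a] takes part in the stages [i < val a j], all of which occur since
    [val a j <= maxdeg A j]. *)
Lemma num_ops_dir j : num_ops (dd_dir j) = (\sum_(a : A) 3 * val a j)%N.
Proof.
rewrite num_ops_flatten (eq_bigr _ (fun i _ => num_ops_stage j i)).
rewrite exchange_big /=; apply: eq_bigr => a _; rewrite -big_distrr /=.
by rewrite sum_ltn; apply/congr1/minn_idPr/leq_maxdeg/valP.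
Qed.

Lemma num_ops_newton s :
  num_ops (newton_prog s) = (\sum_(j <- s) \sum_(a : A) 3 * val a j)%N.
Proof.
elim: s => [|j s IHs] /=.
  by rewrite big_nil num_ops_flatten big1.
by rewrite big_cons num_ops_cat IHs num_ops_dir addnC.
Qed.

Lemma num_ops_newton_le : complete A ->
  (num_ops (newton_prog (enum 'I_m)) <= 3 * #|` A| ^ 2)%N.
Proof.
move=> cA; rewrite num_ops_newton exchange_big /=.
have -> : (3 * #|` A| ^ 2 = \sum_(a : A) 3 * #|` A|)%N.
  by rewrite sum_nat_const -cardfE mulnCA.
apply: leq_sum => a _; rewrite -big_distrr leq_mul2l /= big_enum -mdegE.
apply/ltnW/mdeg_lt_card => b /mnm_lepP; apply: cA; exact: valP.
Qed.

(** * Correctness of the program by Hoare-style triples *)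

Section Correctness.

Variables (R : realType) (p : nat -> 'I_m -> R) (f : 'rV[R]_m -> R).
Hypotheses (cA : complete A) (dp : distinct_nodes A p).
Implicit Types (V W : 'X_{1..m} -> R) (st : {ffun 'I_S -> R}).

Let run (os : option {ffun 'I_S -> R}) (q : prog) :=
  foldl (fun os c => obind (exec_instr (read_input p f) c) os) os q.

Definition holds st V := forall a : A, st (reg a) = V (val a).

(** Total correctness: the run also never divides by zero. The scratch registers are left
    unconstrained. *)
Definition triple V (q : prog) W := forall st, holds st V ->
  exists2 st', run (Some st) q = Some st' & holds st' W.

Lemma triple_cat V1 V2 V3 q1 q2 :
  triple V1 q1 V2 -> triple V2 q2 V3 -> triple V1 (q1 ++ q2) V3.
Proof.
move=> t1 t2 st /t1[st1 e1 /t2[st2 e2 h2]]; exists st2 => //.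
by rewrite /run foldl_cat -/(run _ q1) e1.
Qed.

Lemma triple_eq V V' W W' q :
  {in A, V =1 V'} -> {in A, W =1 W'} -> triple V q W -> triple V' q W'.
Proof.
move=> eV eW t st hst; have [|st' e h'] := t st.
  by move=> a; rewrite hst eV //; exact: valP.
by exists st' => // a; rewrite h' eW //; exact: valP.
Qed.

(** The table in the middle of a loop from [V] to [W], when the entries in [l] have been updated. *)
Definition mix V W (l : seq A) b := if b \in map val l then W b else V b.

(** Induction from the right. The premise asks each body to be correct whichever other entries have
    been updated before it. *)
Lemma triple_loop V W (body : A -> prog) (l : seq A) : uniq l ->
  (forall l' a, a \in l -> a \notin l' ->
     triple (mix V W l') (body a) (mix V W (rcons l' a))) ->
  triple V (flatten [seq body a | a <- l]) (mix V W l).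
Proof.
elim/last_ind: l => [_ _|l a IHl]; first by move=> st hst; exists st.
rewrite rcons_uniq map_rcons flatten_rcons => /andP[al ul] tbody.
apply: triple_cat (tbody l a _ al); last by rewrite mem_rcons mem_head.
apply: IHl => // l' b bl; apply: tbody.
by rewrite mem_rcons inE bl orbT.
Qed.

Lemma mix_rcons V W l (a : A) b :
  mix V W (rcons l a) b = if b == val a then W b else mix V W l b.
Proof. by rewrite /mix map_rcons mem_rcons inE; case: eqP. Qed.

Lemma reg_eq (a b : A) : (reg a == reg b) = (val a == val b).
Proof. by rewrite (inj_eq (@lshift_inj _ _)) (inj_eq enum_rank_inj). Qed.

Lemma reg_tmp a i : (reg a == tmp i) = false.
Proof. exact: eq_lrshift. Qed.

Lemma triple_load V :
  triple V load_values (fun b => f (grid_pt p b)).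
Proof.
pose W b := f (grid_pt p b).
apply: (@triple_eq V V (mix V W (enum {: A})) W) => //.
  move=> b bA; rewrite /mix; case: mapP => // -[].
  by exists [` bA]%fset; rewrite ?mem_enum.
apply: triple_loop => [|l a _ _ st hst]; first exact: enum_uniq.
eexists; first by [].
move=> b; rewrite mix_rcons ffunE reg_eq; case: eqP => [->//|_].
exact: hst.
Qed.

Lemma triple_block V j i (a : A) : (i < val a j)%N ->
  triple V (dd_block j i a)
    (fun b => if b == val a
              then (V b - V (mset b j i)) / (p (b j) j - p i j) else V b).
Proof.
move=> ia st hst; have aA : val a \in A := valP a.
have neq := node_neq dp aA ia.
have le_a := leq_maxdeg j aA.
rewrite /run /= !ffunE !eqxx /=.
have t01 : (tmp ord0 == tmp ord_max) = false.
  by rewrite (inj_eq (@rshift_inj _ _)).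
rewrite !reg_tmp t01 !inordK ?ltnS ?(leq_trans (ltnW ia)) // subr_eq0.
rewrite (negPf neq) /=; eexists; first by [].
move=> b; rewrite !ffunE reg_eq !reg_tmp !hst /=; case: eqP => // eq_b.
by rewrite eq_b insubdK //; apply: mset_in => //; apply: ltnW.
Qed.

(** The table after [i] stages: the entry of [b] stops changing at order [b j], hence the
    minimum. *)
Definition dd_partial (G : 'X_{1..m} -> R) j i (b : 'X_{1..m}) :=
  dd_along p j G (minn i (b j)) b.

(* The update is in place: the operand of [a], namely [mset a j i], has
   [j]-entry [i] and is therefore not overwritten during stage [i]. *)
Lemma triple_stage G j i :
  triple (dd_partial G j i) (dd_stage j i) (dd_partial G j i.+1).
Proof.
set l := enum [pred a : A | (i < val a j)%N].
have lE (a : A) : (a \in l) = (i < val a j)%N by rewrite mem_enum.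
apply: (@triple_eq (dd_partial G j i) _
  (mix (dd_partial G j i) (dd_partial G j i.+1) l)) => // [b bA|].
  rewrite /mix; case: mapP => // nl; rewrite /dd_partial.
  have [ib|bi] := ltnP i (b j); last by rewrite !(minn_idPr _) // leqW.
  by case: nl; exists [` bA]%fset; rewrite ?lE.
apply: triple_loop => [|l' a]; first exact: enum_uniq.
rewrite lE => ia al'.
have tb := triple_block
  (V := mix (dd_partial G j i) (dd_partial G j i.+1) l') ia.
apply: (triple_eq _ _ tb) => // b bA.
rewrite mix_rcons; case: eqP => // ->.
have mixa : mix (dd_partial G j i) (dd_partial G j i.+1) l' (val a)
    = dd_along p j G i (val a).
  by rewrite /mix (mem_map val_inj) (negPf al') /dd_partial
    (minn_idPl (ltnW ia)).
(* At [mset a j i] the order is capped at [i], so the old and new tables agree there and membership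
   in [l'] does not matter. *)
have mixb : mix (dd_partial G j i) (dd_partial G j i.+1) l' (mset (val a) j i)
    = dd_along p j G i (mset (val a) j i).
  by rewrite /mix /dd_partial msetE eqxx minnn (minn_idPr (leqnSn i)) if_same.
by rewrite mixa mixb /dd_partial (minn_idPl ia).
Qed.

Lemma triple_dir G j :
  triple G (dd_dir j) (fun a => dd_along p j G (a j) a).
Proof.
have stages n : triple G (flatten [seq dd_stage j i | i <- iota 0 n])
    (dd_partial G j n).
  elim: n => [|n IHn].
    by move=> st hst; exists st => // a; rewrite hst /dd_partial min0n.
  rewrite -addn1 iotaD add0n map_cat flatten_cat /= cats0 addn1.
  by apply: (triple_cat IHn); apply: triple_stage.
apply: triple_eq (stages (maxdeg A j)) => // b bA.
by rewrite /dd_partial (minn_idPr (leq_maxdeg j bA)).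
Qed.

(** The initial table [V] is arbitrary because loading overwrites every entry. *)
Lemma triple_newton V s : triple V (newton_prog s) (dd_dirs p f s).
Proof.
elim: s => [|j s IHs] /=; first exact: triple_load.
by apply: (triple_cat IHs); apply: triple_dir.
Qed.

End Correctness.

Lemma newton_prog_computes (R : realType) (p : nat -> 'I_m -> R)
    (f : 'rV[R]_m -> R) : complete A -> distinct_nodes A p ->
  computes (read_input p f) (newton_prog (enum 'I_m)) reg (newton_coef p f).
Proof.
move=> cA dp.
have [a|st e h] := @triple_newton R p f cA dp (fun=> 0) (enum 'I_m) [ffun=> 0].
  by rewrite ffunE.
by exists st.
Qed.

End Program.

Theorem theorem3p3 :
  exists C : nat,
  forall (m : nat) (A : {fset 'X_{1..m}}),
  (0 < m)%N -> A != fset0 -> complete A ->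
  exists (S : nat) (prog : seq (instr A S)) (out : A -> 'I_S),
    [/\ (num_ops prog <= C * #|` A| ^ 2)%N,
        (S <= C * #|` A|)%N
      & forall (R : realType) (p : nat -> 'I_m -> R) (f : 'rV[R]_m -> R),
        distinct_nodes A p ->
        computes (read_input p f) prog out (newton_coef p f) /\
        exists Q : {mpoly R[m]},
          unique (fun Q' => in_Pi A Q' /\ interpolates A p f Q') Q /\
          Q = \sum_(a <- A) newton_coef p f a *: newton_poly p a].
Proof.
(* Three operations per block; also [#|A| + 2 <= 3 * #|A|] as [A] is non-empty. *)
exists 3%N => m A _ A0 cA.
exists (#|{: A}| + 2)%N, (newton_prog A (enum 'I_m)), (@reg m A); split.
- exact: num_ops_newton_le.
- by rewrite -cardfE mulSn leq_add2l leq_pmulr // cardfs_gt0.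
move=> R p f dp; split; first exact: newton_prog_computes.
pose g a := f (grid_pt p a).
(* The Newton form holds by conversion: [dd_iter] on the data [g] unfolds to [newton_coef p f]. *)
exists (newton_interp A p g); split=> //; split=> [|Q' [Q'Pi Q'f]].
  split; first exact: newton_interp_in_Pi.
  by move=> a aA; apply: newton_interp_eval.
apply: (in_Pi_eval_inj cA dp) => // [|b bA]; first exact: newton_interp_in_Pi.
by rewrite newton_interp_eval // Q'f.
Qed.
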